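(* Fix $\beta\in(0,1)$. Let $\{Z_k\}_{k\ge1}$ be i.i.d. $\mathrm{Bernoulli}(1/2)$, sampled once. Let $p(k)=c\,k^{-1/\beta}$ ($k\ge1$) with $c$ the normalizing constant. Let $X_n=((k_1,Z_{k_1}),\dots,(k_n,Z_{k_n}))$ and $Y_m=((k'_1,Z_{k'_1}),\dots,(k'_m,Z_{k'_m}))$, where $k_1,\dots,k_n,k'_1,\dots,k'_m$ are i.i.d. with law $p$, independent of the $Z$'s (both sequences use the same $Z$'s). Let $C_\beta>0$ be the constant such that $U(n)=\sum_{k\ge1}[1-(1-p(k))^n]\sim C_\beta n^\beta$ as $n\to\infty$. Then, to leading asymptotic order, $$I(X_n;Y_m)=C_\beta\left[n^\beta+m^\beta-(n+m)^\beta\right],$$ i.e. the process has generalized Hilberg (GHC) scaling $I(X_n;Y_m)\propto n^\beta+m^\beta-(n+m)^\beta$.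
   Context: $I(X;Y)=H(X)+H(Y)-H(X,Y)$ is Shannon mutual information with entropies in bits. $U(n)$ is the expected number of distinct indices among $n$ independent draws from $p$. *)

(* Defs.v *)
From HB Require Import structures.
From mathcomp Require Import all_boot all_order all_algebra.
From mathcomp Require Import all_classical all_reals all_analysis.
Set Implicit Arguments. Unset Strict Implicit. Unset Printing Implicit Defensive.
Import Order.TTheory GRing.Theory Num.Theory.
Import numFieldNormedType.Exports.
Local Open Scope classical_set_scope.
Local Open Scope ring_scope.

Section Defs.
Variable R : realType.

Definition zeta_beta (beta : R) : R :=
  limn (series (fun k : nat => (k.+1)%:R `^ (- beta^-1))).
Definition cnorm (beta : R) : R := (zeta_beta beta)^-1.

Definition pk (beta : R) (k : nat) : R :=
  if k is 0 then 0 else cnorm beta * (k%:R `^ (- beta^-1)).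

(** U(n) = sum_{k>=1} [1 - (1 - p(k))^n]  (the k = 0 term is 0). *)
Definition Ufun (beta : R) (n : nat) : R :=
  limn (series (fun k : nat => 1 - (1 - pk beta k) ^+ n)).

Definition ghc (beta : R) (n m : nat) : R :=
  n%:R `^ beta + m%:R `^ beta - (n + m)%:R `^ beta.

Context {d : measure_display} {T : measurableType d}.

Definition ent_term (q : R) : R := - (q * (ln q / ln 2)).

Definition entropy {U : choiceType} (P : probability T R) (X : T -> U)
  : \bar R :=
  (\esum_(u in [set: U]) (ent_term (fine (P (X @^-1` [set u]))))%:E)%E.

Definition mutinf {U V : choiceType} (P : probability T R)
  (X : T -> U) (Y : T -> V) : R :=
  fine (entropy P X) + fine (entropy P Y)
  - fine (entropy P (fun t => (X t, Y t))).

(** X_n = ((k_1, Z_{k_1}), ..., (k_n, Z_{k_n})) with k_i = K (i-1). *)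
Definition sample (Z : nat -> T -> bool) (K : nat -> T -> nat) (n : nat)
  : T -> seq (nat * bool) :=
  fun t => [seq (K i t, Z (K i t) t) | i <- iota 0 n].

(** Mutual independence of the discrete family {Z_k}_k, {K_i}_i, {K'_j}_j:
    the joint pmf of every finite initial sub-family factorizes (this
    is equivalent to the product rule for every finite sub-family, by
    summing out the extra coordinates). *)
Definition mutually_indep (P : probability T R) (Z : nat -> T -> bool)
  (K K' : nat -> T -> nat) : Prop :=
  forall (N : nat) (z : nat -> bool) (a b : nat -> nat),
    fine (P [set t | (forall k, (k < N)%N -> Z k t = z k)
                  /\ (forall i, (i < N)%N -> K i t = a i)
                  /\ (forall j, (j < N)%N -> K' j t = b j)])
    = (\prod_(k < N) fine (P [set t | Z k t = z k]))
      * (\prod_(i < N) fine (P [set t | K i t = a i]))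
      * (\prod_(j < N) fine (P [set t | K' j t = b j])).

End Defs.

(* Main.v *)
Require Import Defs.
From HB Require Import structures.
From mathcomp Require Import all_boot all_order all_algebra.
From mathcomp Require Import all_classical all_reals all_analysis.
From mathcomp Require Import ring lra.
Import Order.TTheory GRing.Theory Num.Theory.
Import numFieldNormedType.Exports.
Local Open Scope classical_set_scope.
Local Open Scope ring_scope.

(* Given the indices, the observed bits are determined by one fair bit per
   distinct index, so H(X_n) = n H(p) + U(n), and likewise for the pair
   (X_n, Y_m), which is a sample of size n + m.  As H(p) is finite,
   I(X_n; Y_m) = U(n) + U(m) - U(n + m) exactly.

   Replacing 1 - (1 - p(k))^n by 1 - exp(- n p(k)) changes U(n) by at most 1 and
   gives W(n^beta), where W(t) = sum_(k >= 1) g(k / t) for the nonincreasing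
   g(x) = 1 - exp(- c x^(-1/beta)).  Grouping the terms in blocks of length q
   gives q W(t) <= W(q t) <= q (W(t) + 1), so W(t) / t converges to its
   supremum C over t >= 1, and U(n) ~ C n^beta.

   This does not control U(n + m) - U(m) when n is much smaller than m; there
   concavity of U gives U(n + m) - U(m) <= n U(m) / m = O(n^beta (n / m)^(1 - beta)),
   which is negligible against (1 - beta) n^beta <= n^beta + m^beta - (n + m)^beta. *)

(** * Expected number of distinct indices *)

Section NonnegSeries.
Context {R : realType}.
Implicit Types f g : nat -> R.

Lemma cvg_series_le f M : (forall k, 0 <= f k) -> (forall n, series f n <= M) ->
  cvgn (series f).
Proof.
move=> f0 fM; apply: nondecreasing_is_cvgn.
  by apply: nondecreasing_series => i _ _; exact: f0.
by exists M => _ [n _ <-].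
Qed.

Lemma series_le_lim f n : (forall k, 0 <= f k) -> cvgn (series f) ->
  series f n <= limn (series f).
Proof.
move=> f0 cf; apply: (nondecreasing_cvgn_le _ cf).
by apply: nondecreasing_series => i _ _; exact: f0.
Qed.

Lemma lim_series_ge0 f : (forall k, 0 <= f k) -> cvgn (series f) ->
  0 <= limn (series f).
Proof. by move=> f0 cf; have := series_le_lim f 0 f0 cf; rewrite seriesEnat/= big_geq. Qed.

Lemma lim_series_leP f M : cvgn (series f) -> (forall n, series f n <= M) ->
  limn (series f) <= M.
Proof. by move=> cf fM; apply: limr_le => //; apply: nearW. Qed.

Lemma cvg_series_shiftS f l : series (fun k => f k.+1) @ \oo --> l ->
  series f @ \oo --> f 0%N + l.
Proof.
move=> cf; rewrite -cvg_shiftS.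
rewrite (_ : (fun n => _) = (fun n => f 0%N + series (fun k => f k.+1) n)).
  by apply: cvgD => //; exact: cvg_cst.
by apply/funext => n; rewrite !seriesEnat/= big_nat_recl// big_add1.
Qed.

End NonnegSeries.

(** * Convergence of the series of [k^(-a)] for [a > 1] *)

Section PowerSeries.
Context {R : realType} (a : R).
Hypothesis a1 : 1 < a.

Let f (k : nat) : R := k.+1%:R `^ (- a).

Let f_ge0 k : 0 <= f k. Proof. exact: powR_ge0. Qed.

Let f_double k : f k.*2.+1 = 2 `^ (- a) * f k.
Proof. by rewrite /f -powRM// -natrM mul2n. Qed.

Let f_anti j k : (j <= k)%N -> f k <= f j.
Proof.
move=> jk; rewrite /f !powRN lef_pV2 ?posrE ?powR_gt0//.
apply: ge0_ler_powR; rewrite ?nnegrE// ?ler_nat//.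
by move: a1; lra.
Qed.

(** Cauchy condensation: after the first term, each pair [f (2k+1)], [f (2k+2)] is at most twice
    [f (2k+1) = 2^(-a) f k]. *)
Let series_double N : series f N.*2.+1 <= 1 + 2 * 2 `^ (- a) * series f N.
Proof.
rewrite !seriesEnat/=; elim: N => [|N IH].
  by rewrite big_nat1 big_geq// /f powR1 mulr0 addr0.
rewrite doubleS (big_nat_recr N.*2.+2)//= (big_nat_recr N.*2.+1)//=.
rewrite (big_nat_recr N)//= mulrDr.
have := f_double N; have : f N.*2.+2 <= f N.*2.+1 by exact: f_anti.
by move: IH; lra.
Qed.

(** As [S_N <= S_(2N+1) <= 1 + r S_N] with [r = 2^(1-a) < 1], all partial sums stay below
    [1 / (1 - r)]. *)
Lemma cvg_series_powRN : cvgn (series (fun k : nat => k.+1%:R `^ (- a) : R)).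
Proof.
set r : R := 2 * 2 `^ (- a).
have r1 : r < 1.
  rewrite /r -[X in X * _](@powRr1 R 2)// -powRD; last by apply/implyP.
  have : 2 `^ (1 - a) < 2 `^ 0 :> R.
    rewrite /powR pnatr_eq0/= ltr_expR mul0r nmulr_rlt0 ?ln_gt0 ?ltr1n//.
    by rewrite subr_lt0.
  by rewrite powRr0.
apply: (@cvg_series_le _ _ (1 - r)^-1) => // n.
have : series f n <= series f n.*2.+1.
  apply: nondecreasing_series => [i _ _|]; first exact: f_ge0.
  by rewrite -addnn -addnS leq_addr.
have := series_double n; rewrite -/r -[X in _ <= X -> _]/(1 + r * series f n) => h1 h2.
rewrite -[_^-1]mul1r ler_pdivlMr ?subr_gt0//.
by rewrite mulrBr mulr1 mulrC -/f; lra.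
Qed.

End PowerSeries.

(** * Linear growth of [W t] *)

Section Scaling.
Context {R : realType} (g : R -> R).
Hypothesis g_anti : forall x y : R, 0 < x -> x <= y -> g y <= g x.
Hypothesis g01 : forall x, 0 <= g x <= 1.
Hypothesis g_cvg : forall t : R, 0 < t -> cvgn (series (fun k => g (k.+1%:R / t))).

(** [W t / t] is the right-endpoint Riemann sum, with mesh [1 / t], of the integral of [g] over the
    positive half-line. *)
Definition scaled_sum (t : R) : R := limn (series (fun k => g (k.+1%:R / t))).
Local Notation W := scaled_sum.

Let g_ge0 x : 0 <= g x. Proof. by case/andP: (g01 x). Qed.
Let g_le1 x : g x <= 1. Proof. by case/andP: (g01 x). Qed.

Lemma scaled_sum_ge0 (t : R) : 0 < t -> 0 <= W t.
Proof. by move=> t0; apply: lim_series_ge0 => //; exact: g_cvg. Qed.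

Lemma scaled_sum_homo (s t : R) : 0 < s -> s <= t -> W s <= W t.
Proof.
move=> s0 st; have t0 := lt_le_trans s0 st.
apply: lim_series_le; [exact: g_cvg|exact: g_cvg|] => k; apply: g_anti.
  by rewrite divr_gt0.
by rewrite ler_pM2l// lef_pV2.
Qed.

(** Each of the [q] terms [j] in the block from [k q] to [(k+1) q - 1] has argument
    [(j+1) / (q t) <= (k+1) / t]. *)
Lemma scaled_sum_mul_ge q (t : R) : 0 < t -> (0 < q)%N -> q%:R * W t <= W (q%:R * t).
Proof.
move=> t0 q0; have q0' : 0 < q%:R :> R by rewrite ltr0n.
have qt0 : 0 < q%:R * t by rewrite mulr_gt0.
rewrite mulrC -ler_pdivlMr//; apply: lim_series_leP; first exact: g_cvg.
move=> n; rewrite ler_pdivlMr//.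
apply: le_trans (series_le_lim _ (n * q)%N _ (g_cvg _ qt0)) => //.
rewrite !seriesEnat/= big_mkord big_nat_mul big_mkord mulr_suml.
apply: ler_sum => k _.
rewrite mulr_natr -[X in _ *+ X](_ : (k.+1 * q - k * q = q)%N); last first.
  by rewrite -mulnBl subSnn mul1n.
rewrite -sumr_const_nat !big_nat; apply: ler_sum => j /andP[_ jk].
apply: g_anti; first by rewrite divr_gt0.
rewrite ler_pdivrMr// [leRHS](_ : _ = (k.+1 * q)%:R).
  by rewrite ler_nat.
by rewrite natrM; field; rewrite !gt_eqF.
Qed.

(** In the same blocks [(j+1) / (q t) >= k / t], so [g (k / t)] bounds every term when [k > 0].
    Block 0 is bounded by [g <= 1] instead, which costs the extra [q]. *)
Lemma scaled_sum_mul_le q (t : R) : 0 < t -> (0 < q)%N ->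
  W (q%:R * t) <= q%:R * (W t + 1).
Proof.
move=> t0 q0; have q0' : 0 < q%:R :> R by rewrite ltr0n.
have qt0 : 0 < q%:R * t by rewrite mulr_gt0.
apply: lim_series_leP; first exact: g_cvg.
move=> n; set h := fun k => g (k.+1%:R / (q%:R * t)).
have hge0 k : 0 <= h k by exact: g_ge0.
apply: (@le_trans _ _ (series h (n.+1 * q)%N)).
  apply: nondecreasing_series => [i _ _//|].
  by rewrite mulSn (leq_trans (leq_pmulr n q0))// leq_addl.
have blk k : \sum_(k * q <= j < (k.+1 * q)%N) h j <=
    q%:R * (if k is k'.+1 then g (k'.+1%:R / t) else 1).
  rewrite mulrC mulr_natr -[X in _ *+ X](_ : (k.+1 * q - k * q = q)%N); last first.
    by rewrite -mulnBl subSnn mul1n.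
  rewrite -sumr_const_nat !big_nat; apply: ler_sum => j /andP[jk _].
  case: k jk => [|k] jk; first exact: g_le1.
  apply: g_anti; first by rewrite divr_gt0.
  rewrite ler_pdivlMr// [leLHS](_ : _ = (k.+1 * q)%:R).
    by rewrite ler_nat; exact: leq_trans jk _.
  by rewrite natrM; field; rewrite !gt_eqF.
rewrite seriesEnat/= big_nat_mul.
apply: (le_trans (ler_sum _ (fun k _ => blk k))).
rewrite -mulr_sumr ler_pM2l// big_nat_recl//= addrC lerD2r.
have := series_le_lim (fun k => g (k.+1%:R / t)) n (fun=> g_ge0 _) (g_cvg _ t0).
by rewrite seriesEnat.
Qed.

(** A point [t0] that nearly attains the supremum controls every large [t]: rounding [t / t0] down
    to [q] gives [W t >= q W(t0) >= (t / t0 - 1) W(t0)]. *)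
Lemma scaled_sum_div_cvg : 0 < g 1 ->
  exists2 C : R, 0 < C &
    forall e, 0 < e -> exists A, forall t, A <= t -> `|W t / t - C| <= e.
Proof.
move=> g1; pose E := [set W t / t | t in [set t : R | 1 <= t]].
(* With [q] the integer part of [t >= 1], [W t <= W (q+1) <= (q+1) (W 1 + 1)] and [q + 1 <= 2 t]. *)
have ub : ubound E (2 * (W 1 + 1)).
  move=> _ [t /= t1 <-]; have t0 : 0 < t by lra.
  rewrite ler_pdivrMr//.
  have := Num.Theory.truncn_itv (ltW t0).
  set q := Num.truncn t => /andP[qt tq].
  have := scaled_sum_mul_le q.+1 1 ltr01 isT; rewrite mulr1.
  have := scaled_sum_homo _ _ t0 (ltW tq).
  have W1 := scaled_sum_ge0 1 ltr01.
  move=> h1 h2; apply: (le_trans (le_trans h1 h2)).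
  rewrite mulrAC ler_wpM2r//; first lra.
  by rewrite -natr1; lra.
have hs : has_sup E by split; [exists (W 1 / 1), 1 => //=|exists (2 * (W 1 + 1))].
have W1 : 0 < W 1.
  apply: lt_le_trans (series_le_lim _ 1 (fun=> g_ge0 _) (g_cvg _ ltr01)).
  by rewrite seriesEnat/= big_nat1 divr1.
have leC t : 1 <= t -> W t / t <= sup E.
  by move=> t1; apply: ub_le_sup; [case: hs|exists t].
exists (sup E); first by have := leC 1 (lexx _); rewrite divr1; exact: lt_le_trans.
move=> e e0.
have [_ [t0 /= t01 <-] ht0] := sup_adherent (divr_gt0 e0 (ltr0Sn R 1)) hs.
have t00 : 0 < t0 by lra.
have Wt0 := scaled_sum_ge0 t0 t00.
(* Beyond this threshold the rounding loss [W t0 / t] is at most [e / 2]; the other [e / 2] is the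
   gap left by [t0]. *)
exists (Num.max t0 (2 * W t0 / e)) => t; rewrite ge_max => /andP[t0t Wt].
have t_gt0 : 0 < t by lra.
have := leC t (le_trans t01 t0t) => htC.
rewrite ler_norml; apply/andP; split; last by lra.
have := Num.Theory.truncn_itv (ltW (divr_gt0 t_gt0 t00)).
set q := Num.truncn _ => /andP[qt tq].
have q0 : (0 < q)%N.
  by rewrite -ltnS -(ltr_nat R); apply: le_lt_trans tq; rewrite ler_pdivlMr// mul1r.
have h1 := scaled_sum_mul_ge q t0 t00 q0.
have h2 : W (q%:R * t0) <= W t.
  apply: scaled_sum_homo; first by rewrite mulr_gt0// ltr0n.
  by rewrite -ler_pdivlMr.
have h3 : (t / t0 - 1) * W t0 <= W t.
  apply: le_trans (le_trans h1 h2); rewrite ler_wpM2r//.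
  by move: tq; rewrite -natr1; lra.
have h4 : W t0 / t <= e / 2.
  rewrite ler_pdivrMr//; move: Wt; rewrite ler_pdivrMr//; lra.
have h5 : W t0 / t0 - W t0 / t <= W t / t.
  rewrite [leLHS](_ : _ = (t / t0 - 1) * W t0 / t); last by field; rewrite !gt_eqF.
  by rewrite ler_wpM2r// invr_ge0 ltW.
move: ht0; lra.
Qed.

End Scaling.

(** * Comparison of [(1 - p)^n] with [exp(- n p)] *)

Section PoissonApprox.
Context {R : realType}.
Implicit Types p x : R.

Lemma one_sub_expr_le p n : 0 <= p <= 1 -> 1 - (1 - p) ^+ n <= n%:R * p.
Proof.
move=> /andP[p0 p1]; elim: n => [|n IH]; first by rewrite expr0 mul0r subrr.
rewrite exprS -natr1.
have : 0 <= p * (1 - (1 - p) ^+ n).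
  by rewrite mulr_ge0// subr_ge0 exprn_ile1//; lra.
by move: IH; lra.
Qed.

Lemma one_add_expr_ge p n : 0 <= p -> 1 + n%:R * p <= (1 + p) ^+ n.
Proof.
move=> p0; elim: n => [|n IH]; first by rewrite expr0 mul0r addr0.
rewrite exprS -natr1.
have : 0 <= p * ((1 + p) ^+ n - 1).
  by rewrite mulr_ge0// subr_ge0 exprn_ege1//; lra.
by move: IH; lra.
Qed.

Lemma expr_one_sub_le_expR p n : 0 <= p <= 1 -> (1 - p) ^+ n <= expR (- (n%:R * p)).
Proof.
move=> /andP[p0 p1]; rewrite -mulrN expRM_natl.
by rewrite lerXn2r ?nnegrE ?expR_ge0 ?subr_ge0//; exact: expR_ge1Dx.
Qed.

(* Since e^-p <= 1/(1+p), the difference is at most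
   (1+p)^-n (1 - (1-p^2)^n) <= n p^2 / (1 + n p) <= p. *)
Lemma expR_sub_expr_le p n : 0 <= p <= 1 ->
  expR (- (n%:R * p)) - (1 - p) ^+ n <= p.
Proof.
move=> /andP[p0 p1].
have q0 : 0 < (1 + p) ^+ n by rewrite exprn_gt0//; lra.
have h1 : expR (- (n%:R * p)) <= ((1 + p) ^+ n)^-1.
  rewrite expRN lef_pV2 ?posrE ?expR_gt0// expRM_natl.
  by rewrite lerXn2r ?nnegrE ?expR_ge0 ?addr_ge0//; exact: expR_ge1Dx.
have h2 : 1 - ((1 - p) * (1 + p)) ^+ n <= n%:R * (p * p).
  rewrite (_ : (1 - p) * (1 + p) = 1 - p * p); last by ring.
  by apply: one_sub_expr_le; rewrite mulr_ge0//= mulr_ile1.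
have h3 := one_add_expr_ge p n p0.
rewrite (le_trans (lerB h1 (lexx _)))//.
rewrite -(ler_pM2r q0) mulrBl mulVf ?gt_eqF// -exprMn.
apply: (le_trans h2); have : p * (1 + n%:R * p) <= p * (1 + p) ^+ n by rewrite ler_wpM2l.
by rewrite mulrDr mulr1 mulrCA mulrA; lra.
Qed.

End PoissonApprox.

(** * The power law [p] and the growth of [U] *)

Section ExpectedDistinct.
Context {R : realType} (beta : R).
Hypotheses (hb0 : 0 < beta) (hb1 : beta < 1).

Local Notation p := (pk beta).
Local Notation c := (cnorm beta).

Let a_gt1 : 1 < beta^-1. Proof. by rewrite invf_gt1. Qed.

Lemma cnorm_gt0 : 0 < c.
Proof.
rewrite invr_gt0.
have h := series_le_lim _ 1 (fun=> powR_ge0 _ _) (cvg_series_powRN _ a_gt1).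
apply: lt_le_trans h; by rewrite seriesEnat/= big_nat1 powR1.
Qed.

Lemma pk_ge0 k : 0 <= p k.
Proof. by case: k => [//|k]; rewrite mulr_ge0 ?powR_ge0// ltW ?cnorm_gt0. Qed.

Lemma series_pk_cvg : series p @ \oo --> (1 : R).
Proof.
rewrite -[X in _ --> X]add0r; apply: (cvg_series_shiftS p).
rewrite -(mulVf (_ : zeta_beta beta != 0)); last first.
  by have := cnorm_gt0; rewrite invr_gt0 => /gt_eqF ->.
rewrite (_ : series _ = (fun n => c * series (fun k : nat => k.+1%:R `^ (- beta^-1)) n)).
  by apply: cvgM; [exact: cvg_cst|exact: cvg_series_powRN].
by apply/funext => n; rewrite !seriesEnat/= mulr_sumr.
Qed.

Lemma series_pk_le1 n : series p n <= 1.
Proof.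
have := series_le_lim p n pk_ge0 (cvgP _ series_pk_cvg).
by rewrite (cvg_lim _ series_pk_cvg).
Qed.

Lemma pk_le1 k : p k <= 1.
Proof.
apply: le_trans (series_pk_le1 k.+1); rewrite seriesEnat/= big_nat_recr//= lerDr.
by apply: sumr_ge0 => i _; exact: pk_ge0.
Qed.

Let p01 k : 0 <= p k <= 1. Proof. by rewrite pk_ge0 pk_le1. Qed.

Lemma cvg_series_Ufun n : cvgn (series (fun k => 1 - (1 - p k) ^+ n)).
Proof.
apply: (@cvg_series_le _ _ n%:R) => [k|m].
  by rewrite subr_ge0 exprn_ile1// ?subr_ge0 ?pk_le1// lerBlDr lerDl pk_ge0.
apply: (@le_trans _ _ (n%:R * series p m)).
  rewrite !seriesEnat/= mulr_sumr; apply: ler_sum => k _.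
  exact: one_sub_expr_le.
by rewrite ler_piMr ?series_pk_le1.
Qed.

(** At [x = k / n^beta] with [k >= 1] the exponent is [- n p(k)], so [g x] is the probability that a
    Poisson variable of mean [n p(k)] is nonzero. *)
Let g (x : R) := 1 - expR (- (c * x `^ (- beta^-1))).

Let g_anti x y : 0 < x -> x <= y -> g y <= g x.
Proof.
move=> x0 xy; have y0 := lt_le_trans x0 xy.
rewrite /g lerD2l lerN2 ler_expR lerN2 ler_pM2l ?cnorm_gt0//.
rewrite !powRN lef_pV2 ?posrE ?powR_gt0//.
by rewrite ge0_ler_powR ?nnegrE// ?invr_ge0 ltW.
Qed.

Let g01 x : 0 <= g x <= 1.
Proof.
rewrite /g subr_ge0 lerBlDr lerDl expR_ge0 andbT -expR0 ler_expR lerNl oppr0.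
by rewrite mulr_ge0 ?powR_ge0// ltW ?cnorm_gt0.
Qed.

Let g_le x : g x <= c * x `^ (- beta^-1).
Proof. by have := expR_ge1Dx (- (c * x `^ (- beta^-1))); rewrite /g; lra. Qed.

(** As [g x <= c x^(-1/beta)], the terms are dominated by [t^(1/beta) p(k+1)], and [p] has total
    mass 1. *)
Let g_cvg t : 0 < t -> cvgn (series (fun k => g (k.+1%:R / t))).
Proof.
move=> t0; apply: (@cvg_series_le _ _ (t `^ (beta^-1))) => [k|n].
  by case/andP: (g01 (k.+1%:R / t)).
apply: (@le_trans _ _ (t `^ (beta^-1) * series p n.+1)).
  rewrite !seriesEnat/= big_nat_recl//= add0r mulr_sumr; apply: ler_sum => k _.
  apply: (le_trans (g_le _)); rewrite mulrCA ler_pM2l ?cnorm_gt0//.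
  rewrite powRM// ?invr_ge0 ?(ltW t0)// mulrC ler_wpM2r ?powR_ge0//.
  by rewrite -(powR_inv1 (ltW t0)) -powRrM mulrNN mul1r.
by rewrite ler_piMr ?powR_ge0 ?series_pk_le1.
Qed.

Let g_scale n k : (0 < n)%N -> g (k.+1%:R / n%:R `^ beta) = 1 - expR (- (n%:R * p k.+1)).
Proof.
move=> n0; rewrite /g /= mulrCA powRM// ?invr_ge0 ?powR_ge0//.
rewrite -powRN -powRrM mulrNN mulfV ?gt_eqF// powRr1 ?ler0n//.
by rewrite (mulrC n%:R).
Qed.

(** Termwise the difference is [exp(- n p(k)) - (1 - p(k))^n], which lies between 0 and [p(k)]; the
    [p(k)] sum to 1. *)
Lemma Ufun_near_scaled_sum n : (0 < n)%N ->
  `|Ufun beta n - scaled_sum g (n%:R `^ beta)| <= 1.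
Proof.
move=> n0; have t0 : 0 < n%:R `^ beta :> R by rewrite powR_gt0// ltr0n.
set e := fun k => 1 - expR (- (n%:R * p k)).
have cW : series e @ \oo --> scaled_sum g (n%:R `^ beta).
  rewrite -[X in _ --> X]add0r (_ : 0 = e 0%N); last first.
    by rewrite /e /= mulr0 oppr0 expR0 subrr.
  apply: cvg_series_shiftS.
  rewrite (_ : (fun k => _) = (fun k => g (k.+1%:R / n%:R `^ beta))).
    exact: g_cvg.
  by apply/funext => k; rewrite g_scale.
have cU := cvg_series_Ufun n.
have cN : (fun m => `|series (fun k => 1 - (1 - p k) ^+ n) m - series e m|) @ \oo -->
    `|Ufun beta n - scaled_sum g (n%:R `^ beta)|.
  by apply: cvg_norm; apply: cvgB; [exact: cU|exact: cW].
rewrite -(cvg_lim _ cN)//; apply: limr_le; first exact: cvgP cN.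
apply: nearW => m /=; rewrite !seriesEnat/= -sumrB ger0_norm.
  apply: le_trans (series_pk_le1 m); rewrite seriesEnat/=.
  apply: ler_sum => k _; rewrite /e.
  by have := expR_sub_expr_le _ n (p01 k); lra.
apply: sumr_ge0 => k _; rewrite /e.
by have := expr_one_sub_le_expR _ n (p01 k); lra.
Qed.

Lemma nat_powR_ge (M : R) : exists N, forall n, (N <= n)%N -> M <= n%:R `^ beta.
Proof.
exists (Num.truncn (`|M| `^ beta^-1)).+1 => n hn.
apply: (le_trans (ler_norm M)).
have -> : `|M| = (`|M| `^ beta^-1) `^ beta.
  by rewrite -powRrM mulVf ?gt_eqF// powRr1.
apply: (ge0_ler_powR (ltW hb0)); rewrite ?nnegrE ?powR_ge0 ?ler0n//.
apply: ltW.
apply: lt_le_trans (_ : (Num.truncn (`|M| `^ beta^-1)).+1%:R <= _).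
  by have /andP[] := Num.Theory.truncn_itv (powR_ge0 `|M| beta^-1).
by rewrite ler_nat.
Qed.

Lemma Ufun_div_cvg : exists2 C : R, 0 < C &
  (fun n : nat => Ufun beta n / n%:R `^ beta) @ \oo --> C.
Proof.
have g1 : 0 < g 1.
  by rewrite /g powR1 mulr1 subr_gt0 expR_lt1 oppr_lt0 cnorm_gt0.
have [C C0 hC] := scaled_sum_div_cvg g g_anti g01 g_cvg g1.
exists C => //; apply/cvgrPdist_le => e e0.
have [A hA] := hC _ (divr_gt0 e0 (ltr0Sn R 1)).
(* [A] brings [W(t) / t] within [e / 2] of [C]; [2 / e] makes the Poissonization error [1 / n^beta]
   at most [e / 2]. *)
have [N hN] := nat_powR_ge (Num.max A (2 / e)).
near=> n.
have n0 : (0 < n)%N by near: n; exact: nbhs_infty_gt.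
have t0 : 0 < n%:R `^ beta :> R by rewrite powR_gt0// ltr0n.
have : Num.max A (2 / e) <= n%:R `^ beta.
  by apply: hN; near: n; exact: nbhs_infty_ge.
rewrite ge_max => /andP[/hA h1]; rewrite ler_pdivrMr// => h2.
rewrite distrC (le_trans (ler_distD (scaled_sum g (n%:R `^ beta) / n%:R `^ beta) _ _))//.
rewrite [leRHS](splitr e) lerD// -mulrBl normrM normfV (gtr0_norm t0) ler_pdivrMr//.
by apply: (le_trans (Ufun_near_scaled_sum n n0)); lra.
Unshelve. all: by end_near.
Qed.

End ExpectedDistinct.

(** * Asymptotics of U(n) + U(m) - U(n + m) *)

Section GhcAsymptotics.
Context {R : realType} (beta : R).
Hypotheses (hb0 : 0 < beta) (hb1 : beta < 1).

(** Young's inequality for [(1+x)^beta] and 1, with conjugate exponents [1/beta] and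
    [1/(1-beta)]. *)
Lemma powR_one_add_le (x : R) : 0 <= x -> (1 + x) `^ beta <= 1 + beta * x.
Proof.
move=> x0; have b1 : 0 < 1 - beta by rewrite subr_gt0.
have := @conjugate_powR R ((1 + x) `^ beta) 1 beta^-1 (1 - beta)^-1.
rewrite !invrK powR1 -powRrM mulfV ?gt_eqF// powRr1 ?addr_ge0//.
rewrite powR_ge0 ler01 !invr_gt0 (addrC beta) subrK => /(_ isT isT hb0 b1 erefl).
by lra.
Qed.

Section Ratio.
Variables (n m : nat).
Hypotheses (n0 : (0 < n)%N) (nm : (n <= m)%N).
Local Notation x := (n%:R / m%:R : R).

Let n0' : 0 < n%:R :> R. Proof. by rewrite ltr0n. Qed.
Let m0 : 0 < m%:R :> R. Proof. by rewrite ltr0n (leq_trans n0). Qed.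
Let x0 : 0 < x. Proof. by rewrite divr_gt0. Qed.
Let x1 : x <= 1. Proof. by rewrite ler_pdivrMr// mul1r ler_nat. Qed.

Lemma powR_addn_le : (n + m)%:R `^ beta <= m%:R `^ beta * (1 + beta * x).
Proof.
have -> : (n + m)%:R = m%:R * (1 + x) by rewrite natrD; field; rewrite gt_eqF.
by rewrite powRM ?addr_ge0 ?(ltW x0) ?(ltW m0)// ler_pM2l ?powR_gt0// powR_one_add_le// ltW.
Qed.

Lemma powR_ratioE : m%:R `^ beta * x `^ beta = n%:R `^ beta.
Proof.
by rewrite -powRM ?(ltW x0) ?(ltW m0)//; congr (_ `^ _); field; rewrite gt_eqF.
Qed.

(** The factor [x^(1 - beta)] shows that [m^beta x], the scale of the increment from [m] to [n + m],
    is negligible against [n^beta] when [n] is much smaller than [m]. *)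
Lemma powR_ratio_mulE : m%:R `^ beta * x = n%:R `^ beta * x `^ (1 - beta).
Proof.
rewrite -powR_ratioE -mulrA -powRD; last by apply/implyP => _; rewrite gt_eqF.
by rewrite (addrC beta) subrK powRr1// ltW.
Qed.

(** Since [x <= x^beta], the increment [(n+m)^beta - m^beta <= beta m^beta x] is at most
    [beta n^beta]. Hence an error small against [n^beta] is small relative to [ghc], uniformly in
    [m >= n]. *)
Lemma ghc_ge : (1 - beta) * n%:R `^ beta <= ghc beta n m.
Proof.
have h := powR_addn_le.
have h2 : m%:R `^ beta * x <= n%:R `^ beta.
  rewrite -powR_ratioE ler_pM2l ?powR_gt0//.
  by apply: ger1_powR; [rewrite x0 x1|exact: ltW].
have : beta * (m%:R `^ beta * x) <= beta * n%:R `^ beta by rewrite ler_pM2l.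
by rewrite /ghc; move: h; rewrite mulrDr mulr1 (mulrCA _ beta); lra.
Qed.

End Ratio.

Variables (U : nat -> R) (C : R).
Hypothesis C0 : 0 < C.
Hypothesis U_cvg : (fun n : nat => U n / n%:R `^ beta) @ \oo --> C.
Hypothesis U_homo : forall n m, U m <= U (n + m)%N.
(* Concavity of [U], as monotonicity of U(m)/m. *)
Hypothesis U_conc : forall n m, m%:R * U (n + m)%N <= (n + m)%:R * U m.

Let U_near e : 0 < e -> exists N, forall n, (N <= n)%N -> (0 < n)%N ->
  `|U n - C * n%:R `^ beta| <= e * n%:R `^ beta.
Proof.
move=> e0; have /cvgrPdist_le /(_ e e0) [N _ hN] := U_cvg.
exists N => n Nn n0; have t0 : 0 < n%:R `^ beta :> R by rewrite powR_gt0// ltr0n.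
rewrite -ler_pdivrMr// -{2}(gtr0_norm t0) -normfV -normrM mulrBl mulfK ?gt_eqF//.
by rewrite distrC; exact: hN.
Qed.

Let I_ n m := U n + U m - U (n + m)%N.

(** The error is measured by the smaller size [n^beta], whereas the asymptotics of [U m] err on the
    scale [m^beta]. A threshold [dl] on [n / m] separates the regime where both increments are small
    from the one where [m^beta] is comparable to [n^beta]. *)
Lemma ghc_approx e : 0 < e -> exists N, forall n m, (N <= n)%N -> (n <= m)%N ->
  (0 < n)%N -> `|I_ n m - C * ghc beta n m| <= e * n%:R `^ beta.
Proof.
move=> e0; have b1 : 0 < 1 - beta by rewrite subr_gt0.
(* [k] satisfies [(C + 1) k = e / 2], and [dl] is such that [X < dl] forces [X^(1 - beta) <= k]. *)
pose k := e / 2 / (C + 1); have C1 : 0 < C + 1 by rewrite addr_gt0.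
have k0 : 0 < k by rewrite !divr_gt0.
have C0p := C0.
pose dl := k `^ (1 - beta)^-1; have dl0 : 0 < dl by rewrite powR_gt0.
have dlk : dl `^ (1 - beta) = k by rewrite -powRrM mulVf ?gt_eqF// powRr1// ltW.
have db0 : 0 < dl `^ beta by rewrite powR_gt0.
(* The bound 1 serves [U m <= (C + 1) m^beta], [e / 2] the error of [U n], and the last one a total
   error [3 h m^beta] when [X >= dl]. *)
pose h := Num.min 1 (Num.min (e / 2) (e * dl `^ beta / 6)).
have h0 : 0 < h by rewrite !lt_min ltr01/= !divr_gt0//= mulr_gt0.
have [h1 h2 h3] : [/\ h <= 1, h <= e / 2 & h <= e * dl `^ beta / 6].
  by rewrite !ge_min !lexx !orbT.
have [N hN] := U_near h h0.
exists N => n m Nn nm n0.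
have n0' : 0 < n%:R :> R by rewrite ltr0n.
have m0 : (0 < m)%N by exact: leq_trans nm.
have m0' : 0 < m%:R :> R by rewrite ltr0n.
have nb0 : 0 < n%:R `^ beta :> R by rewrite powR_gt0.
have mb0 : 0 < m%:R `^ beta :> R by rewrite powR_gt0.
have x0 : 0 < n%:R / m%:R :> R by rewrite divr_gt0.
have x1 : n%:R / m%:R <= 1 :> R by rewrite ler_pdivrMr// mul1r ler_nat.
have Nm : (N <= m)%N by exact: leq_trans nm.
have hn := hN n Nn n0; have hm := hN m Nm m0.
have hnm := hN (n + m)%N (leq_trans Nm (leq_addl _ _)) (leq_trans m0 (leq_addl _ _)).
have p1 := powR_addn_le n m n0 nm.
have rE := powR_ratioE n m n0 nm.
have rM := powR_ratio_mulE n m n0 nm.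
set X : R := n%:R / m%:R in x0 x1 p1 rE rM *.
set Mb : R := m%:R `^ beta in mb0 hm p1 rE rM *.
set Nb : R := n%:R `^ beta in nb0 hn rE rM *.
set S : R := (n + m)%:R `^ beta in hnm p1 *.
have pS : Mb <= S.
  by apply: ge0_ler_powR; rewrite ?nnegrE ?ler0n ?ler_nat ?leq_addl// ltW.
have hne : h * Nb <= e / 2 * Nb by rewrite ler_pM2r.
suff br : `|(U (n + m)%N - U m) - C * (S - Mb)| <= e / 2 * Nb.
  rewrite /I_ /ghc -/Nb -/Mb -/S.
  rewrite (_ : _ - _ = (U n - C * Nb) - (U (n + m)%N - U m - C * (S - Mb))); last by ring.
  by apply: (le_trans (ler_normB _ _)); lra.
(* For [X < dl], concavity bounds [U (n + m) - U m] by [X U(m)], and both increments lie between 0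
   and [e / 2 * Nb]. *)
have [xd|xd] := ltP X dl.
  have hX : Mb * X <= k * Nb.
    rewrite rM mulrC ler_pM2r// -dlk.
    by apply: ge0_ler_powR; rewrite ?nnegrE ltW.
  have hU : U (n + m)%N - U m <= X * U m.
    rewrite -(ler_pM2l m0') mulrBr lerBlDr.
    apply: (le_trans (U_conc n m)); rewrite natrD mulrDl lerD2r.
    suff -> : m%:R * (X * U m) = n%:R * U m by [].
    by rewrite /X; field; rewrite gt_eqF.
  have hUm : U m <= (C + 1) * Mb.
    have : h * Mb <= 1 * Mb by rewrite ler_pM2r.
    by move: hm; rewrite ler_norml => /andP[_]; lra.
  have hXU : X * U m <= (C + 1) * (Mb * X).
    by rewrite mulrA [leRHS]mulrC ler_pM2l.
  have kE : (C + 1) * (k * Nb) = e / 2 * Nb.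
    by rewrite mulrA /k; congr (_ * _); field; rewrite gt_eqF.
  have hXk : (C + 1) * (Mb * X) <= e / 2 * Nb by rewrite -kE ler_pM2l.
  have hS : S - Mb <= Mb * X.
    have : beta * (Mb * X) <= 1 * (Mb * X) by apply: ler_wpM2r; apply: ltW => //; exact: mulr_gt0.
    by move: p1; rewrite mulrDr mulr1 (mulrCA _ beta); lra.
  have hCS : C * (S - Mb) <= C * (Mb * X) by rewrite ler_pM2l.
  have hCS0 : 0 <= C * (S - Mb) by rewrite mulr_ge0 ?subr_ge0// ltW.
  have MX0 : 0 < Mb * X by rewrite mulr_gt0.
  have := U_homo n m.
  by rewrite ler_norml => hh; apply/andP; split; lra.
(* For [X >= dl], [m^beta] is at most [dl^(-beta) n^beta], so the errors of the asymptotics at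
   [n + m] and [m] are small on the scale [n^beta]. *)
have hS : S <= 2 * Mb.
  have : Mb * (beta * X) <= Mb * 1.
    by rewrite ler_pM2l//; apply: mulr_ile1 => //; rewrite ltW.
  by move: p1; rewrite mulrDr mulr1; lra.
have hMN : dl `^ beta * Mb <= Nb.
  rewrite -rE mulrC ler_pM2l//.
  by apply: ge0_ler_powR; rewrite ?nnegrE ?(ltW dl0) ?(ltW x0) ?(ltW hb0).
rewrite (_ : _ - _ = (U (n + m)%N - C * S) - (U m - C * Mb)); last by ring.
apply: (le_trans (ler_normB _ _)).
have : h * S <= h * (2 * Mb) by rewrite ler_pM2l.
have : h * (3 * Mb) <= e * dl `^ beta / 6 * (3 * Mb) by rewrite ler_pM2r// mulr_gt0.
have : e * (dl `^ beta * Mb) <= e * Nb by rewrite ler_pM2l.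
by lra.
Qed.

Lemma ghc_ratio_cvg e : 0 < e -> exists N, forall n m, (N <= n)%N -> (N <= m)%N ->
  `|I_ n m / (C * ghc beta n m) - 1| < e.
Proof.
move=> e0; have b1 : 0 < 1 - beta by rewrite subr_gt0.
(* By [ghc_ge], the error [h n^beta] is then at most half of [e C ghc], which leaves room for the
   strict inequality. *)
pose h := e / 2 * (C * (1 - beta)).
have h0 : 0 < h by rewrite !mulr_gt0.
have [N hN] := ghc_approx h h0.
exists N.+1 => n m.
wlog nm : n m / (n <= m)%N => [hw Nn Nm|Nn _].
  have [nm|/ltnW mn] := leqP n m; first exact: hw.
  have -> : I_ n m = I_ m n by rewrite /I_ addnC; ring.
  have -> : ghc beta n m = ghc beta m n by rewrite /ghc addnC; ring.
  exact: hw.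
have n0 : (0 < n)%N by exact: leq_trans Nn.
have nb0 : 0 < n%:R `^ beta :> R by rewrite powR_gt0// ltr0n.
have gge := ghc_ge n m n0 nm.
have g0 : 0 < ghc beta n m by apply: lt_le_trans gge; rewrite mulr_gt0.
have Cg0 : 0 < C * ghc beta n m by rewrite mulr_gt0.
have := hN n m (ltnW Nn) nm n0.
rewrite (_ : _ / _ - 1 = (I_ n m - C * ghc beta n m) / (C * ghc beta n m)); last first.
  by rewrite [in RHS]mulrBl divff // gt_eqF.
rewrite normrM normfV (gtr0_norm Cg0) ltr_pdivrMr// => hI.
apply: (le_lt_trans hI).
have : e / 2 * (C * ((1 - beta) * n%:R `^ beta)) <= e / 2 * (C * ghc beta n m).
  by rewrite ler_pM2l ?divr_gt0// ler_pM2l.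
have : 0 < e * (C * ghc beta n m) by rewrite mulr_gt0.
by rewrite /h !mulrA; lra.
Qed.

End GhcAsymptotics.

(** * Monotonicity and concavity of [U] *)

Section UfunConcave.
Context {R : realType} (beta : R).
Hypotheses (hb0 : 0 < beta) (hb1 : beta < 1).

Local Notation p := (pk beta).

Let y01 k : 0 <= 1 - p k <= 1.
Proof. by rewrite subr_ge0 pk_le1// lerBlDr lerDl pk_ge0. Qed.

Lemma Ufun_homo n m : Ufun beta m <= Ufun beta (n + m).
Proof.
apply: lim_series_le; [exact: cvg_series_Ufun|exact: cvg_series_Ufun|] => k.
rewrite lerD2l lerN2; have /andP[y0 y1] := y01 k.
by rewrite ler_wiXn2l// leq_addl.
Qed.

(** [1 - y^n] is [1 - y] times the sum of [y^i] over [i < n], and each such [y^i] is at least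
    [y^n]. *)
Lemma mul_expr_one_sub_le (y : R) n : 0 <= y <= 1 -> n%:R * (y ^+ n * (1 - y)) <= 1 - y ^+ n.
Proof.
move=> /andP[y0 y1]; elim: n => [|n IH]; first by rewrite mul0r subrr.
have q0 : 0 <= y ^+ n * (1 - y) by rewrite mulr_ge0 ?exprn_ge0// subr_ge0.
have : n.+1%:R * (y * (y ^+ n * (1 - y))) <= n.+1%:R * (y ^+ n * (1 - y)).
  by rewrite ler_pM2l// ler_piMl.
by rewrite exprS -[in X in _ <= X -> _]natr1; move: IH; lra.
Qed.

(** Termwise with [y = 1 - p(k)] this is [m y^m (1 - y^n) <= n (1 - y^m)], which follows from
    [1 - y^n <= n (1 - y)] and [m y^m (1 - y) <= 1 - y^m]. *)
Lemma Ufun_concave n m : m%:R * Ufun beta (n + m) <= (n + m)%:R * Ufun beta m.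
Proof.
have -> : m%:R * Ufun beta (n + m) =
    limn (series (m%:R *: (fun k => 1 - (1 - p k) ^+ (n + m)))).
  by rewrite lim_seriesZ//; exact: cvg_series_Ufun.
have -> : (n + m)%:R * Ufun beta m =
    limn (series ((n + m)%:R *: (fun k => 1 - (1 - p k) ^+ m))).
  by rewrite lim_seriesZ//; exact: cvg_series_Ufun.
apply: lim_series_le; [by apply: is_cvg_seriesZ; exact: cvg_series_Ufun|
  by apply: is_cvg_seriesZ; exact: cvg_series_Ufun|] => k.
rewrite /GRing.scale/=; have := y01 k; set y := 1 - p k => /[dup] y01' /andP[y0 y1].
have h1 := mul_expr_one_sub_le y m y01'.
have h2 : 1 - y ^+ n <= n%:R * (1 - y).
  have -> : 1 - y = p k by rewrite /y; ring.
  by apply: one_sub_expr_le; rewrite pk_ge0 ?pk_le1.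
have ym0 : 0 <= m%:R * y ^+ m by rewrite mulr_ge0// exprn_ge0.
have h3 := ler_wpM2l ym0 h2.
have h4 : n%:R * (m%:R * (y ^+ m * (1 - y))) <= n%:R * (1 - y ^+ m) by rewrite ler_wpM2l.
rewrite natrD exprD -[leLHS]/(_ * _) -[leRHS]/(_ * _); move: h3 h4; lra.
Qed.

End UfunConcave.

(** * Entropy of a sample *)

Section Esum.
Context {R : realType}.
Local Open Scope ereal_scope.

Lemma esum_series (f : nat -> R) : (forall k, 0 <= f k)%R -> cvgn (series f) ->
  \esum_(k in [set: nat]) (f k)%:E = (limn (series f))%:E.
Proof.
move=> f0 cf; rewrite -nneseries_esumT => [|k]; last by rewrite lee_fin.
rewrite -EFin_lim//; congr (limn _); apply/funext => n /=.
by rewrite seriesEnat/= sumEFin.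
Qed.

(** Finite subsums give one inequality for every scalar; applied to [c^-1] and the scaled family it
    gives the other. *)
Lemma ge0_esumZl (T : choiceType) (I : set T) (a : T -> \bar R) (c : R) :
  (0 <= c)%R -> (forall i, 0 <= a i) ->
  \esum_(i in I) (c%:E * a i) = c%:E * \esum_(i in I) a i.
Proof.
have le b (r : R) : (0 <= r)%R -> (forall i, 0 <= b i) ->
    \esum_(i in I) (r%:E * b i) <= r%:E * \esum_(i in I) b i.
  move=> r0 b0; apply: ge_ereal_sup => _ [X [finX XI] <-].
  rewrite -ge0_mule_fsumr//; apply: lee_wpmul2l; first by rewrite lee_fin.
  by apply: ereal_sup_ubound; exists X.
rewrite le_eqVlt => /predU1P[<- a0|c0 a0].
  by rewrite mul0e; apply: esum1 => i _; rewrite mul0e.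
have ca0 i : 0 <= c%:E * a i by rewrite mule_ge0// lee_fin ltW.
have cK x : c^-1%:E * (c%:E * x) = x.
  by rewrite muleA -EFinM mulVf ?mul1e// gt_eqF.
apply/eqP; rewrite eq_le le ?(ltW c0)//=.
have := le _ (c^-1)%R _ ca0; rewrite invr_ge0 (ltW c0) => /(_ isT).
rewrite (eq_esum (fun i _ => cK (a i))) => h.
have := lee_wpmul2l _ h; move=> /(_ c%:E); rewrite lee_fin (ltW c0) => /(_ isT).
by rewrite [X in _ <= X]muleA -EFinM mulfV ?mul1e// gt_eqF.
Qed.

Lemma exchange_esum (T1 T2 : choiceType) (I : set T1) (J : set T2)
    (a : T1 -> T2 -> \bar R) : (forall i j, 0 <= a i j) ->
  \esum_(i in I) \esum_(j in J) a i j = \esum_(j in J) \esum_(i in I) a i j.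
Proof.
move=> a0; rewrite !esum_esum//.
rewrite (reindex_esum (J `*` I) _ (fun x => (x.2, x.1)))//; split=> //=.
- by move=> [j i] [].
- by move=> [j1 i1] [j2 i2] /= _ _ [] -> ->.
- by move=> [i j] [Ii Jj] /=; exists (j, i).
Qed.

Lemma esum_pair_bool (T : choiceType) (a : T * bool -> \bar R) : (forall x, 0 <= a x) ->
  \esum_(x in [set: T * bool]) a x = \esum_(k in [set: T]) (a (k, true) + a (k, false)).
Proof.
move=> a0; rewrite (_ : [set: T * bool] = [set: T] `*`` (fun=> [set: bool])); last first.
  by apply/seteqP; split.
transitivity (\esum_(k in [set: T]) \esum_(b in [set: bool]) a (k, b)).
  by rewrite esum_esum//; apply: eq_esum => -[].
apply: eq_esum => k _.
rewrite (esumID [set true])// setTI esum_set1//; congr (_ + _).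
rewrite (_ : _ `&` _ = [set false]) ?esum_set1//.
by apply/seteqP; split => -[] //=; case.
Qed.

Lemma esum_seqS (T : choiceType) (a : seq T -> \bar R) n : (forall u, 0 <= a u) ->
  \esum_(u in [set u | size u = n.+1]) a u =
  \esum_(u in [set u | size u = n]) \esum_(x in [set: T]) a (x :: u).
Proof.
move=> a0; rewrite esum_esum//.
apply: (reindex_esum _ _ (fun z : seq T * T => z.2 :: z.1)); split => /=.
- by move=> [u x] [/= <-].
- by move=> [u x] [v y] _ _ /= [-> ->].
- by move=> [//|x u] /= [<-]; exists (u, x).
Qed.

Lemma esum_seq0 (T : choiceType) (a : seq T -> \bar R) : 0 <= a [::] ->
  \esum_(u in [set u | size u = 0%N]) a u = a [::].
Proof.
move=> a0; rewrite (_ : [set _ | _] = [set [::]]) ?esum_set1//.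
by apply/seteqP; split => [[]|_ ->].
Qed.

End Esum.

(** * The entropy summand [- q log2 q] *)

Section EntTerm.
Context {R : realType}.
Implicit Types p q : R.

Let ln2_gt0 : 0 < ln 2 :> R. Proof. by rewrite ln_gt0// ltr1n. Qed.

Lemma ent_term0 : ent_term (0 : R) = 0.
Proof. by rewrite /ent_term mul0r oppr0. Qed.

Lemma ent_term1 : ent_term (1 : R) = 0.
Proof. by rewrite /ent_term ln1 mul0r mulr0 oppr0. Qed.

Lemma ent_term_ge0 q : 0 <= q <= 1 -> 0 <= ent_term q.
Proof.
move=> /andP[q0 q1]; rewrite /ent_term -mulrN mulr_ge0// oppr_ge0.
by rewrite pmulr_lle0 ?invr_gt0// ln_le0.
Qed.

(** The chain rule for one atom; zero factors are treated apart because the logarithm of a product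
    is split only for positive factors. *)
Lemma ent_termM p q : 0 <= p -> 0 <= q ->
  ent_term (p * q) = p * ent_term q + q * ent_term p.
Proof.
rewrite le_eqVlt => /predU1P[<- _|p0]; first by rewrite !mul0r ent_term0 mulr0 addr0.
rewrite le_eqVlt => /predU1P[<-|q0]; first by rewrite mulr0 mul0r ent_term0 mulr0 addr0.
by rewrite /ent_term lnM ?posrE//; ring.
Qed.

Lemma ent_term_half p : 0 <= p -> ent_term (p * (1 / 2)) = (ent_term p + p) / 2.
Proof.
move=> p0; rewrite ent_termM// ?divr_ge0//.
rewrite {1}/ent_term mul1r lnV ?posrE// mulNr divff ?gt_eqF//.
by field.
Qed.

(** Apply [ln y <= y] to [y = q^(-s)]. Trading the logarithm for a small power lets the entropy of a
    power law be compared with a convergent power series. *)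
Lemma ent_term_le q s : 0 <= q -> 0 < s < 1 ->
  ent_term q <= (s * ln 2)^-1 * q `^ (1 - s).
Proof.
move=> + /andP[s0 s1]; rewrite le_eqVlt => /predU1P[<-|q0].
  by rewrite ent_term0 mulr_ge0 ?powR_ge0// invr_ge0 mulr_ge0// ltW.
have h := ln_sublinear (powR_gt0 (- s) q0); rewrite ln_powR in h.
have -> : ent_term q = (s * ln 2)^-1 * (q * (- s * ln q)).
  by rewrite /ent_term; field; rewrite !gt_eqF.
rewrite ler_pM2l ?invr_gt0 ?mulr_gt0//.
rewrite powRD; last by apply/implyP => _; rewrite gt_eqF.
by rewrite powRr1 ?ler_pM2l ?ltW// ltW.
Qed.

End EntTerm.

(** * Recursive law of a sample and its chain rule *)

Section SamplePmf.
Context {R : realType} (p : nat -> R).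
Implicit Types (u v : seq (nat * bool)) (x : nat * bool).

Fixpoint lookup (k : nat) u : bool :=
  if u is x :: u' then (if x.1 == k then x.2 else lookup k u') else false.

(* Conditional law of the next observation given the observations in [u]: a
   fresh index carries a fair bit, an index already seen repeats its bit. *)
Definition next_pmf u x : R :=
  p x.1 * (if x.1 \in unzip1 u then (x.2 == lookup x.1 u)%:R else 1 / 2).

(** The head of the list is the latest draw, the reverse of the order in [sample]; the two agree
    because the law is exchangeable, as [sample_pmf_agrees] makes visible. *)
Fixpoint sample_pmf u : R :=
  if u is x :: u' then sample_pmf u' * next_pmf u' x else 1.

Hypothesis p0 : forall k, 0 <= p k.
Hypothesis p1 : (\esum_(k in [set: nat]) (p k)%:E = 1)%E.

Lemma next_pmf_ge0 u x : 0 <= next_pmf u x.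
Proof. by rewrite mulr_ge0//; case: ifP => //; rewrite divr_ge0. Qed.

Lemma sample_pmf_ge0 u : 0 <= sample_pmf u.
Proof. by elim: u => //= x u IH; rewrite mulr_ge0// next_pmf_ge0. Qed.

Lemma prob_le1 k : p k <= 1.
Proof.
rewrite -lee_fin -p1 -(@esum_set1 _ _ k (fun k => (p k)%:E)) ?lee_fin//.
by rewrite esum_mkcond; apply: le_esum => i _; case: ifP => // _; rewrite lee_fin.
Qed.

Let p01 k : 0 <= p k <= 1. Proof. by rewrite p0 prob_le1. Qed.

Lemma next_pmf_le1 u x : next_pmf u x <= 1.
Proof.
apply: mulr_ile1 => //; first by case: ifP => //; rewrite divr_ge0.
  exact: prob_le1.
by case: ifP => _; [case: eqP|lra].
Qed.

Lemma sample_pmf_le1 u : sample_pmf u <= 1.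
Proof.
elim: u => //= x u IH; apply: mulr_ile1 => //.
- exact: sample_pmf_ge0.
- exact: next_pmf_ge0.
- exact: next_pmf_le1.
Qed.

Lemma next_pmf_bool u k : next_pmf u (k, true) + next_pmf u (k, false) = p k.
Proof.
rewrite /next_pmf/=; case: ifP => _; last by field.
by case: lookup; rewrite mulr1 mulr0 ?addr0 ?add0r.
Qed.

Lemma ent_next_pmf_bool u k :
  ent_term (next_pmf u (k, true)) + ent_term (next_pmf u (k, false)) =
  ent_term (p k) + p k * (k \notin unzip1 u)%:R.
Proof.
rewrite /next_pmf/=; case: ifP => _ /=; last first.
  by rewrite ent_term_half//; field.
by case: lookup; rewrite !mulr1 !mulr0 ent_term0 ?addr0 ?add0r.
Qed.

Local Open Scope ereal_scope.

Lemma esum_next_pmf u : \esum_(x in [set: nat * bool]) (next_pmf u x)%:E = 1.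
Proof.
rewrite esum_pair_bool => [|x]; last by rewrite lee_fin next_pmf_ge0.
by rewrite -p1; apply: eq_esum => k _; rewrite -EFinD next_pmf_bool.
Qed.

Lemma esum_sample_pmf n : \esum_(u in [set u | size u = n]) (sample_pmf u)%:E = 1.
Proof.
have pos u : 0 <= (sample_pmf u)%:E by rewrite lee_fin sample_pmf_ge0.
elim: n => [|n IH]; first by rewrite esum_seq0.
rewrite esum_seqS// -[RHS]IH; apply: eq_esum => u _ /=.
under eq_esum do rewrite EFinM.
rewrite ge0_esumZl ?sample_pmf_ge0//; first by rewrite esum_next_pmf mule1.
by move=> x; rewrite lee_fin next_pmf_ge0.
Qed.

Lemma esum_p_neq j : \esum_(k in [set: nat]) (p k * (j != k)%:R)%:E = (1 - p j)%:E.
Proof.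
rewrite EFinB -p1 [in RHS](esumID [set j])/= => [|k _]; last by rewrite lee_fin.
rewrite setTI esum_set1 ?lee_fin// EFinN [X in X - _]addeC addeK// (esumID [set j])/=; last first.
  by move=> k _; rewrite lee_fin mulr_ge0.
rewrite setTI esum_set1 ?eqxx ?mulr0// add0e; apply: eq_esum => k [_ /= kj].
by rewrite (_ : j != k) ?mulr1//; apply/eqP => jk; exact: kj.
Qed.

(** The probability that [n] draws all miss [j]: in the induction the bit of the new draw is summed
    out by [next_pmf_bool], then its index by [esum_p_neq]. *)
Lemma esum_sample_pmf_notin j n :
  \esum_(u in [set u | size u = n]) (sample_pmf u * (j \notin unzip1 u)%:R)%:E =
  ((1 - p j) ^+ n)%:E.
Proof.
have pos u : 0 <= (sample_pmf u * (j \notin unzip1 u)%:R)%:E.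
  by rewrite lee_fin mulr_ge0 ?sample_pmf_ge0.
elim: n => [|n IH]; first by rewrite esum_seq0//= mulr1 expr0.
rewrite esum_seqS// exprSr EFinM -IH.
rewrite muleC -ge0_esumZl ?subr_ge0 ?prob_le1//.
apply: eq_esum => u _; rewrite -esum_p_neq muleC.
rewrite -ge0_esumZl => [||k]; last 2 first.
- by rewrite mulr_ge0 ?sample_pmf_ge0.
- by rewrite lee_fin mulr_ge0.
rewrite esum_pair_bool//.
apply: eq_esum => k _; rewrite -EFinD -EFinM; congr EFin.
rewrite /= -(next_pmf_bool u k) inE negb_or -mulnb natrM.
by ring.
Qed.

Definition sample_entropy n := \esum_(u in [set u | size u = n]) (ent_term (sample_pmf u))%:E.

Definition expected_distinct n := \esum_(k in [set: nat]) (1 - (1 - p k) ^+ n)%:E.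

(** [p(k) (1 - p(k))^n] is the probability that index [k] first appears at draw [n + 1]. *)
Lemma expected_distinctS n : expected_distinct n.+1 =
  expected_distinct n + \esum_(k in [set: nat]) (p k * (1 - p k) ^+ n)%:E.
Proof.
have y0 k : (0 <= 1 - p k <= 1)%R by rewrite subr_ge0 prob_le1 lerBlDr lerDl p0.
rewrite -esumD => [|k _|k _]; last 2 first.
- by have /andP[? ?] := y0 k; rewrite lee_fin subr_ge0 exprn_ile1.
- by have /andP[? ?] := y0 k; rewrite lee_fin mulr_ge0// exprn_ge0.
by apply: eq_esum => k _; rewrite -EFinD exprS; congr EFin; ring.
Qed.

Variable h : R.
Hypothesis p_ent : \esum_(k in [set: nat]) (ent_term (p k))%:E = h%:E.

Lemma ent_next_pmf_ge0 u x : (0 <= ent_term (next_pmf u x))%R.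
Proof. by apply: ent_term_ge0; rewrite next_pmf_ge0 next_pmf_le1. Qed.

Lemma ent_sample_pmf_ge0 u : (0 <= ent_term (sample_pmf u))%R.
Proof. by apply: ent_term_ge0; rewrite sample_pmf_ge0 sample_pmf_le1. Qed.

(** Conditional entropy of the next observation given [u]: [h] for the index, plus one bit with the
    probability that the index is fresh. *)
Lemma esum_ent_next_pmf u : \esum_(x in [set: nat * bool]) (ent_term (next_pmf u x))%:E =
  h%:E + \esum_(k in [set: nat]) (p k * (k \notin unzip1 u)%:R)%:E.
Proof.
rewrite esum_pair_bool => [|x]; last by rewrite lee_fin ent_next_pmf_ge0.
rewrite -p_ent -esumD => [|k _|k _]; last 2 first.
- by rewrite lee_fin ent_term_ge0.
- by rewrite lee_fin mulr_ge0.
by apply: eq_esum => k _; rewrite -!EFinD ent_next_pmf_bool.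
Qed.

(** Chain rule: the entropy grows by the conditional entropy of the next observation averaged over
    [u], and [k] is absent from [u] with probability [(1 - p k)^n]. *)
Lemma sample_entropyS n : sample_entropy n.+1 =
  sample_entropy n + h%:E + \esum_(k in [set: nat]) (p k * (1 - p k) ^+ n)%:E.
Proof.
have h0 : (0 <= h)%R.
  by rewrite -lee_fin -p_ent; apply: esum_ge0 => k _; rewrite lee_fin ent_term_ge0.
have q0 u k : 0 <= (sample_pmf u * (p k * (k \notin unzip1 u)%:R))%:E.
  by rewrite lee_fin mulr_ge0 ?sample_pmf_ge0// mulr_ge0.
have q0' u k : 0 <= (p k * (k \notin unzip1 u)%:R)%:E by rewrite lee_fin mulr_ge0.
rewrite /sample_entropy esum_seqS => [|u]; last by rewrite lee_fin ent_sample_pmf_ge0.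
transitivity (\esum_(u in [set u | size u = n])
    ((ent_term (sample_pmf u))%:E + (h * sample_pmf u)%:E +
     \esum_(k in [set: nat]) (sample_pmf u * (p k * (k \notin unzip1 u)%:R))%:E)).
  apply: eq_esum => u _ /=.
  under eq_esum do rewrite ent_termM ?sample_pmf_ge0 ?next_pmf_ge0// EFinD 2!EFinM.
  rewrite esumD => [|x _|x _]; last 2 first.
  - by rewrite mule_ge0 ?lee_fin ?sample_pmf_ge0 ?ent_next_pmf_ge0.
  - by rewrite mule_ge0 ?lee_fin ?next_pmf_ge0 ?ent_sample_pmf_ge0.
  under [X in _ + X]eq_esum do rewrite muleC.
  rewrite !ge0_esumZl ?sample_pmf_ge0 ?ent_sample_pmf_ge0//; first last.
  - by move=> x; rewrite lee_fin ent_next_pmf_ge0.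
  - by move=> x; rewrite lee_fin next_pmf_ge0.
  rewrite esum_next_pmf mule1 esum_ent_next_pmf ge0_muleDr ?lee_fin//; last exact: esum_ge0.
  under [in RHS]eq_esum do rewrite EFinM.
  rewrite [in RHS]ge0_esumZl ?sample_pmf_ge0//.
  by rewrite -EFinM addeC addeA mulrC.
rewrite esumD => [|u _|u _]; last 2 first.
- by rewrite -EFinD lee_fin addr_ge0 ?mulr_ge0 ?ent_sample_pmf_ge0 ?sample_pmf_ge0.
- exact: esum_ge0.
congr (_ + _).
  rewrite esumD => [|u _|u _]; last 2 first.
  - by rewrite lee_fin ent_sample_pmf_ge0.
  - by rewrite lee_fin mulr_ge0 ?sample_pmf_ge0.
  congr (_ + _); under eq_esum do rewrite EFinM.
  rewrite ge0_esumZl// ?esum_sample_pmf ?mule1// => u.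
  by rewrite lee_fin sample_pmf_ge0.
rewrite exchange_esum//; apply: eq_esum => k _.
rewrite EFinM -esum_sample_pmf_notin -ge0_esumZl//; last first.
  by move=> u; rewrite lee_fin mulr_ge0 ?sample_pmf_ge0.
by apply: eq_esum => u _; rewrite -EFinM; congr EFin; ring.
Qed.

Lemma sample_entropyE n : sample_entropy n = (n%:R * h)%:E + expected_distinct n.
Proof.
elim: n => [|n IH].
  rewrite /sample_entropy esum_seq0/= ?ent_term1// mul0r add0e.
  by rewrite /expected_distinct esum1// => k _; rewrite expr0 subrr.
rewrite sample_entropyS IH expected_distinctS -natr1 mulrDl mul1r EFinD.
by rewrite !addeA; congr (_ + _); rewrite addeAC.
Qed.

End SamplePmf.

(** * Law of a pair of samples *)

Section Consistency.
Context {R : realType} (p : nat -> R).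
Implicit Types (u v : seq (nat * bool)) (f : nat -> bool).

(** [f] stands for a realization of all the bits. A list that agrees with no [f] repeats an index
    with opposite bits and has probability 0. *)
Definition agrees f u := all (fun x => x.2 == f x.1) u.

Lemma agreesE f u : agrees f u -> u = [seq (k, f k) | k <- unzip1 u].
Proof. by elim: u => //= -[k b] u IH /andP[/= /eqP-> /IH <-]. Qed.

Lemma lookup_agrees f u k : agrees f u -> k \in unzip1 u -> lookup k u = f k.
Proof.
elim: u => //= -[j b] u IH /andP[/= /eqP -> fu]; rewrite inE eq_sym.
by case: eqVneq => [->//|_ /=]; exact: IH.
Qed.

(** Each entry contributes the mass of its index and each distinct index one fair bit. This
    order-free form is the one that independence produces. *)
Lemma sample_pmf_agrees f u : agrees f u -> sample_pmf p u =
  (\prod_(k <- unzip1 u) p k) * (1 / 2) ^+ size (undup (unzip1 u)).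
Proof.
elim: u => [|[k b] u IH] /=; first by rewrite big_nil mulr1.
move=> /andP[/= /eqP -> fu]; rewrite big_cons IH// /next_pmf/=.
set h : R := 1 / 2; case: ifP => ku; last by rewrite /= exprS; ring.
by rewrite (lookup_agrees f)// eqxx mulr1; ring.
Qed.

Lemma sample_pmf_neq0 u : sample_pmf p u != 0 -> exists f, agrees f u.
Proof.
elim: u => [_|[k b] u IH] /=; first by exists xpredT.
rewrite mulf_eq0 negb_or => /andP[/IH[f fu]]; rewrite /next_pmf/=.
case: ifP => ku.
  rewrite (lookup_agrees f)//; case: (eqVneq b (f k)) => [bf _|_]; last by rewrite mulr0 eqxx.
  by exists f; rewrite /agrees/= bf eqxx.
(* Resetting [f] at the fresh index [k] keeps the agreement with [u], where [k] does not occur. *)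
move=> _; exists (fun j => if j == k then b else f j); rewrite /agrees/= !eqxx/=.
apply/allP => x xu; case: (x.1 =P k) => [xk|_]; last exact: (allP fu).
by move: ku; rewrite -xk (map_f fst xu).
Qed.

End Consistency.

(** * Factorization over subfamilies *)

Section Marginals.
Context {R : realType} {d : measure_display} {T : measurableType d}.
Variables (P : probability T R) (W : nat -> T -> nat) (M : nat).
Hypothesis W_meas : forall l v, measurable [set t | W l t = v].

Let q l v : R := fine (P [set t | W l t = v]).

Let PE A : measurable A -> P A = (fine (P A))%:E.
Proof. by move=> mA; rewrite fineK// fin_num_measure. Qed.

Definition cylinder (S : pred nat) (a : nat -> nat) : set T :=
  [set t | forall l, (l < M)%N -> S l -> W l t = a l].

Lemma measurable_cylinder S a : measurable (cylinder S a).
Proof.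
rewrite (_ : cylinder S a =
    \bigcap_l (if (l < M)%N && S l then [set t | W l t = a l] else setT)).
  by apply: bigcapT_measurable => l; case: ifP.
apply/seteqP; split => t /= h.
  by move=> l _; case: ifP => // /andP[lM Sl]; exact: h.
by move=> l lM Sl; have := h l I; rewrite lM Sl.
Qed.

Hypothesis indep : forall a,
  fine (P (cylinder xpredT a)) = \prod_(l < M) q l (a l).

Lemma sum_marginal l : (\sum_(v <oo) P [set t | W l t = v] = 1)%E.
Proof.
rewrite -(@probability_setT _ _ _ P) (_ : setT = \bigcup_v [set t | W l t = v]).
  rewrite measure_bigcup//=; last by move=> i j _ _ [t [/= <- <-]].
  by apply: eq_eseriesl => i; apply/esym/mem_set.
by apply/seteqP; split => // t _; exists (W l t).
Qed.

(** The product rule is given with all [M] coordinates fixed; the free ones are summed out one at a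
    time, each marginal having total mass 1. *)
Lemma cylinder_prod (S : pred nat) a :
  fine (P (cylinder S a)) = \prod_(l < M | S l) q l (a l).
Proof.
(* Induction on [j], with all coordinates from [j] on constrained; at [j = M] this condition is
   void. *)
suff: forall j (S : pred nat) a, (forall l, (j <= l < M)%N -> S l) ->
    fine (P (cylinder S a)) = \prod_(l < M | S l) q l (a l).
  by move/(_ M); apply => l /andP[Ml /(leq_ltn_trans Ml)]; rewrite ltnn.
elim=> [|j IH] {}S {}a hS.
  transitivity (fine (P (cylinder xpredT a))).
    congr (fine (P _)); apply/seteqP; split => t /= h l lM Sl.
      by apply: h => //; exact: hS.
    exact: h.
  by rewrite indep; apply: eq_bigl => l; rewrite hS/=.
have [Sj|Sj] := boolP (S j).
  apply: IH => l /andP[]; rewrite leq_eqVlt => /predU1P[<-//|jl lM].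
  by apply: hS; rewrite jl.
have [jM|Mj] := ltnP j M; last first.
  by apply: IH => l /andP[jl /(leq_ltn_trans jl)]; rewrite ltnNge Mj.
(* Coordinate [j] is free: the cylinder is the disjoint union over [v] of those that also fix it to
   [v]. *)
pose S' l := S l || (l == j).
pose a' v l := if l == j then v else a l.
have hS' l : (j <= l < M)%N -> S' l.
  move=> /andP[]; rewrite leq_eqVlt /S' => /predU1P[<-|jl lM]; first by rewrite eqxx orbT.
  by rewrite hS// jl.
set c := \prod_(l < M | S l) _.
have c0 : 0 <= c by apply: prodr_ge0 => l _; rewrite fine_ge0.
have E : cylinder S a = \bigcup_v cylinder S' (a' v).
  apply/seteqP; split => [t /= h|t [v _] h l lM Sl].
    exists (W j t) => // l lM; rewrite /S' /a'; case: eqP => [->//|_].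
    by rewrite orbF; exact: h.
  have := h l lM; rewrite /S' Sl /a'; case: eqP => [lj|_]; last exact.
  by move: Sj; rewrite -lj Sl.
have cE v : P (cylinder S' (a' v)) = (c%:E * P [set t | W j t = v])%E.
  rewrite PE; last exact: measurable_cylinder.
  rewrite IH// (bigD1 (Ordinal jM)) ?/S' ?eqxx ?orbT//= {1}/a' eqxx.
  rewrite [in RHS]PE// -EFinM mulrC; congr (_ * _)%:E.
  apply: eq_big => [l|l /andP[_ lj]].
    rewrite -val_eqE/=; case: eqP => [->|_]; last by rewrite orbF andbT.
    by rewrite andbF (negbTE Sj).
  by rewrite /a'; move: lj; rewrite -val_eqE/= => /negbTE ->.
rewrite E measure_bigcup//=; last 2 first.
- by move=> v _; exact: measurable_cylinder.
- move=> v w _ _ [t [hv hw]]; have := hv j jM; have := hw j jM.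
  by rewrite /S' /a' eqxx orbT => <-// <-.
rewrite (eq_eseriesl (Q := xpredT)) => [|i]; last exact/mem_set.
by under eq_eseriesr do rewrite cE; rewrite nneseriesZl// sum_marginal mule1.
Qed.

End Marginals.

(** * Law and entropy of the observations under [P] *)

Section SampleLaw.
Context {R : realType} {d : measure_display} {T : measurableType d}.
Variables (P : probability T R) (p : nat -> R).
Variables (Z : nat -> T -> bool) (K K' : nat -> T -> nat).
Hypothesis hZmeas : forall k (b : bool), measurable [set t | Z k t = b].
Hypothesis hKmeas : forall i k, measurable [set t | K i t = k].
Hypothesis hK'meas : forall j k, measurable [set t | K' j t = k].
Hypothesis hZlaw : forall k, P [set t | Z k t = true] = (1 / 2)%:E.
Hypothesis hKlaw : forall i k, P [set t | K i t = k] = (p k)%:E.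
Hypothesis hK'law : forall j k, P [set t | K' j t = k] = (p k)%:E.
Hypothesis hindep : mutually_indep P Z K K'.

(* The three families laid out in consecutive blocks of length [N]. *)
Definition joint_family (N l : nat) (t : T) : nat :=
  if (l < N)%N then nat_of_bool (Z l t)
  else if (l < N + N)%N then K (l - N)%N t else K' (l - (N + N))%N t.

Local Notation W := joint_family.

Let blockK_ltF N i : (N + i < N)%N = false.
Proof. by rewrite ltnNge leq_addr. Qed.

Let blockK'_ltF N j : (N + N + j < N)%N = false.
Proof. by rewrite -addnA ltnNge leq_addr. Qed.

Lemma joint_familyZ N l t : (l < N)%N -> W N l t = Z l t.
Proof. by rewrite /W => ->. Qed.

Lemma joint_familyK N i t : (i < N)%N -> W N (N + i)%N t = K i t.
Proof. by rewrite /W blockK_ltF ltn_add2l addKn => ->. Qed.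

Lemma joint_familyK' N j t : W N (N + N + j)%N t = K' j t.
Proof. by rewrite /W blockK'_ltF blockK_ltF addKn. Qed.

Lemma bool_nat_eqE (b : bool) (v : nat) : (v <= 1)%N ->
  (nat_of_bool b = v) = (b = (v == 1%N)) :> Prop.
Proof. by case: v => [|[|v]]; case: b => // _; apply: propext; split. Qed.

Lemma measurable_joint_family N l v : measurable [set t | W N l t = v].
Proof.
rewrite /W; case: (l < N)%N => /=; last by case: (l < N + N)%N.
have [v1|v1] := leqP v 1.
  rewrite (_ : [set t | _] = [set t | Z l t = (v == 1%N)]) //.
  by apply/seteqP; split => t /=; rewrite bool_nat_eqE.
rewrite (_ : [set t | _] = set0)//; apply/seteqP; split => // t /= h.
by move: v1; rewrite -h; case: (Z l t).
Qed.

Lemma joint_family_indep N a :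
  fine (P (cylinder (W N) (N + N + N)%N xpredT a)) =
  \prod_(l < N + N + N) fine (P [set t | W N l t = a l]).
Proof.
(* Bits are coded as 0 and 1; if [a] prescribes a larger value in the first block, both sides are
   0. *)
have [/forallP a1|] := boolP [forall k : 'I_N, (a k <= 1)%N]; last first.
  rewrite negb_forall => /existsP[k]; rewrite -ltnNge => ak.
  have kN : (k < N + N + N)%N by rewrite -addnA ltn_addr.
  have neq t : W N k t <> a k.
    by rewrite joint_familyZ// => h; move: ak; rewrite -h; case: (Z k t).
  rewrite (bigD1 (Ordinal kN))//= [X in fine (P X) * _](_ : _ = set0); last first.
    by apply/seteqP; split => // t /= /neq.
  rewrite measure0 mul0r (_ : cylinder _ _ _ _ = set0) ?measure0//.
  by apply/seteqP; split => // t /(_ k kN isT) /neq.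
have := hindep N (fun k => a k == 1%N) (fun i => a (N + i)%N) (fun j => a (N + N + j)%N).
rewrite !big_split_ord/= => h; transitivity (fine (P [set t |
  (forall k, (k < N)%N -> Z k t = (a k == 1%N)) /\
  (forall i, (i < N)%N -> K i t = a (N + i)%N) /\
  (forall j, (j < N)%N -> K' j t = a (N + N + j)%N)])).
  congr (fine (P _)); apply/seteqP; split => t /= H.
    split=> [k kN|]; last split=> [i iN|j jN].
    - rewrite -bool_nat_eqE ?(a1 (Ordinal kN))// -(@joint_familyZ N)//.
      by apply: H => //; rewrite -addnA ltn_addr.
    - rewrite -(@joint_familyK N)//; apply: H => //.
      by rewrite ltn_addr// ltn_add2l.
    - by rewrite -(@joint_familyK' N); apply: H => //; rewrite ltn_add2l.
  move: H => [HZ [HK HK']] l lM _.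
  have [lN|Nl] := ltnP l N.
    by rewrite joint_familyZ// HZ// bool_nat_eqE ?(a1 (Ordinal lN)).
  have [lN|NNl] := ltnP l (N + N)%N.
    rewrite -(subnKC Nl) joint_familyK ?HK//; last by rewrite ltn_subLR.
    by rewrite ltn_subLR.
  by rewrite -(subnKC NNl) joint_familyK' HK'// ltn_subLR.
rewrite h; congr (_ * _ * _); apply: eq_bigr => k _; congr (fine (P _)).
- apply/seteqP; split => t /=.
    by rewrite joint_familyZ// bool_nat_eqE.
  by rewrite joint_familyZ// bool_nat_eqE.
- by apply/seteqP; split => t /=; rewrite joint_familyK.
- by apply/seteqP; split => t /=; rewrite joint_familyK'.
Qed.

Lemma fair_bit_law k b : P [set t | Z k t = b] = (1 / 2)%:E.
Proof.
case: b => //; rewrite (_ : [set t | _] = ~` [set t | Z k t = true]); last first.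
  by apply/seteqP; split => t /=; case: (Z k t).
by rewrite probability_setC// hZlaw -EFinB; congr EFin; field.
Qed.

(** Turns the event into coordinate constraints. Bits are constrained by index and not by draw, so
    the random composition [Z (K i t) t] disappears. *)
Lemma sample_agreesP (L : nat -> T -> nat) n u f t : agrees f u -> size u = n ->
  sample Z L n t = u <->
  (forall i, (i < n)%N -> L i t = nth 0%N (unzip1 u) i) /\
  (forall k, k \in unzip1 u -> Z k t = f k).
Proof.
move=> fu un; have uE := agreesE f u fu; split.
  move=> su; split=> [i ni|k].
    by rewrite -su /sample /unzip1 -map_comp (nth_map 0%N) ?size_iota// nth_iota.
  rewrite -{1}su /sample /unzip1 -map_comp => /mapP[i iin /= kE].
  have : (k, Z k t) \in u by rewrite -su kE; apply/mapP; exists i.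
  by move=> /(allP fu)/= /eqP.
move=> [hL hZ]; rewrite uE.
have -> : unzip1 u = [seq L i t | i <- iota 0 n].
  apply: (@eq_from_nth _ 0%N); first by rewrite !size_map un size_iota.
  move=> i; rewrite /unzip1 size_map un => ni.
  by rewrite (nth_map 0%N) ?size_iota// nth_iota// hL.
rewrite -map_comp; apply/eq_in_map => i; rewrite mem_iota/= => ni.
by rewrite hZ// hL//; apply: mem_nth; rewrite /unzip1 size_map un.
Qed.

Lemma prod_take_nth (s : seq nat) N : (size s <= N)%N ->
  \prod_(i < N | (i < size s)%N) p (nth 0%N s i) = \prod_(k <- s) p k.
Proof.
move=> sN; rewrite (big_nth 0%N) (big_nat_widen _ _ N)//= big_mkord.
by apply: eq_bigl.
Qed.

Lemma prod_half_mem (s : seq nat) N : (forall k, k \in s -> (k < N)%N) ->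
  \prod_(k < N | (k : nat) \in s) (1 / 2) = (1 / 2 : R) ^+ size (undup s).
Proof.
move=> sN; rewrite -(big_mkord (fun k => k \in s) (fun=> 1 / 2 : R)) -big_filter.
rewrite (perm_big (undup s)); last first.
  apply: uniq_perm; rewrite ?filter_uniq ?iota_uniq ?undup_uniq// => k.
  rewrite mem_filter mem_undup mem_index_iota/=.
  by case: (boolP (k \in s)) => //= /sN.
by rewrite big_const_seq count_predT iter_mulr_1.
Qed.

(** A consistent pair of lists is a cylinder of the joint family, so its probability is a product of
    marginals. An inconsistent pair is impossible, since [Z] itself would be a common assignment. *)
Lemma sample_joint_law n m u v : size u = n -> size v = m ->
  P [set t | sample Z K n t = u /\ sample Z K' m t = v] = (sample_pmf p (u ++ v))%:E.
Proof.
move=> un vm; have [[f fuv]|nf] := pselect (exists f, agrees f (u ++ v)); last first.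
  have [->|/sample_pmf_neq0/nf//] := eqVneq (sample_pmf p (u ++ v)) 0.
  rewrite (_ : [set t | _] = set0) ?measure0//; apply/seteqP; split => // t /= [su sv].
  apply: nf; exists (Z ^~ t); rewrite /agrees all_cat.
  by apply/andP; split; [rewrite -su|rewrite -sv]; apply/allP => _ /mapP[i _ ->] /=.
have /andP[fu fv] : agrees f u && agrees f v by rewrite -all_cat.
rewrite (sample_pmf_agrees _ _ _ fuv).
set ks := unzip1 (u ++ v); have ksE : ks = unzip1 u ++ unzip1 v by exact: map_cat.
(* [N] bounds both sample sizes and exceeds every observed index, so blocks of length [N] contain
   all the constrained coordinates. *)
have [N [nN mN kN]] : exists N, [/\ (n <= N)%N, (m <= N)%N &
    forall k, k \in ks -> (k < N)%N].
  exists (n + m + (\max_(k <- ks) k).+1)%N; split.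
  - by rewrite -addnA leq_addr.
  - by rewrite addnAC leq_addl.
  - move=> k kin; rewrite addnS ltnS (leq_trans _ (leq_addl _ _))//.
    by rewrite (big_rem k)//= leq_maxl.
pose S l := if (l < N)%N then l \in ks
  else if (l < N + N)%N then (l - N < n)%N else (l - (N + N) < m)%N.
pose a l := if (l < N)%N then nat_of_bool (f l)
  else if (l < N + N)%N then nth 0%N (unzip1 u) (l - N)%N
  else nth 0%N (unzip1 v) (l - (N + N))%N.
have mW := @measurable_joint_family N.
rewrite (_ : [set t | _] = cylinder (W N) (N + N + N)%N S a); last first.
  apply/seteqP; split => t /=.
    move=> [/(sample_agreesP K n u f t fu un)[hK hZ]].
    move=> /(sample_agreesP K' m v f t fv vm)[hK' hZ'] l lM.
    rewrite /S /a /W; case: ltnP => [lN|Nl].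
      by rewrite ksE mem_cat => /orP[/hZ|/hZ'] ->.
    by case: ltnP => [lN|NNl]; [exact: hK|exact: hK'].
  move=> h.
  have hZ k : k \in ks -> Z k t = f k.
    move=> kin; have kN' := kN k kin.
    have := h k; rewrite /S /a /W kN' -addnA ltn_addr// => /(_ isT kin).
    by case: (Z k t) (f k) => -[].
  split; apply/(sample_agreesP _ _ _ f) => //; split.
  - move=> i ni; have iN := leq_trans ni nN.
    have := h (N + i)%N; rewrite joint_familyK// /S /a blockK_ltF.
    by rewrite ltn_add2l iN addKn ltn_addr ?ltn_add2l//; apply.
  - by move=> k kin; apply: hZ; rewrite ksE mem_cat kin.
  - move=> j jm; have jN := leq_trans jm mN.
    have := h (N + N + j)%N; rewrite joint_familyK' /S /a blockK'_ltF blockK_ltF.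
    by rewrite addKn ltn_add2l; apply.
  - by move=> k kin; apply: hZ; rewrite ksE mem_cat kin orbT.
rewrite -[LHS]fineK; last by rewrite fin_num_measure//; exact: measurable_cylinder.
rewrite (cylinder_prod _ _ _ mW (joint_family_indep N)); congr EFin.
(* The first block yields a half per distinct index, the other two the masses of the drawn
   indices. *)
rewrite big_mkcond/= !big_split_ord/= -!big_mkcond/=.
rewrite -(prod_half_mem _ _ kN) ksE big_cat/= -(prod_take_nth _ N) ?size_map ?un//.
rewrite -(prod_take_nth _ N) ?size_map ?vm//.
rewrite [RHS]mulrC [RHS]mulrA.
congr (_ * _ * _).
- apply: eq_big => [l|l _].
    by rewrite /S ltn_ord ksE.
  rewrite (_ : [set t | _] = [set t | Z l t = f l]) ?fair_bit_law//.
  apply/seteqP; split => t /=; rewrite /W /a ltn_ord; last by move=> ->.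
  by case: (Z l t) (f l) => -[].
- apply: eq_big => [l|l _].
    by rewrite /S blockK_ltF ltn_add2l ltn_ord addKn.
  rewrite (_ : [set t | _] = [set t | K l t = nth 0%N (unzip1 u) l]) ?hKlaw//.
  by apply/seteqP; split => t /=; rewrite joint_familyK// /a blockK_ltF ltn_add2l ltn_ord addKn.
- apply: eq_big => [l|l _].
    by rewrite /S blockK'_ltF blockK_ltF addKn.
  rewrite (_ : [set t | _] = [set t | K' l t = nth 0%N (unzip1 v) l]) ?hK'law//.
  by apply/seteqP; split => t /=; rewrite joint_familyK'// /a blockK'_ltF blockK_ltF addKn.
Qed.

(** The joint law with an empty second sample gives the atoms; lists of any other length have
    probability 0 and entropy term 0. *)
Lemma entropy_sampleE n : entropy P (sample Z K n) = sample_entropy p n.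
Proof.
rewrite /sample_entropy esum_mkcond; apply: eq_esum => u _.
case: ifPn => [|un].
  rewrite inE/= => un; have := sample_joint_law n 0 u [::] un erefl; rewrite cats0 => uE.
  rewrite -[sample_pmf p u]/(fine (sample_pmf p u)%:E) -uE.
  by congr (ent_term (fine (P _)))%:E; apply/seteqP; split => t /= => [->|[]].
rewrite (_ : _ @^-1` _ = set0) ?measure0 ?ent_term0//.
apply/seteqP; split => // t /= su; move: un; rewrite notin_setE => un.
by apply: un; rewrite /= -su size_map size_iota.
Qed.

Lemma entropy_sampleE' m : entropy P (sample Z K' m) = sample_entropy p m.
Proof.
rewrite /sample_entropy esum_mkcond; apply: eq_esum => u _.
case: ifPn => [|un].
  rewrite inE/= => un; have := sample_joint_law 0 m [::] u erefl un; rewrite cat0s => uE.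
  rewrite -[sample_pmf p u]/(fine (sample_pmf p u)%:E) -uE.
  by congr (ent_term (fine (P _)))%:E; apply/seteqP; split => t /= => [->|[]].
rewrite (_ : _ @^-1` _ = set0) ?measure0 ?ent_term0//.
apply/seteqP; split => // t /= su; move: un; rewrite notin_setE => un.
by apply: un; rewrite /= -su size_map size_iota.
Qed.

(** Concatenation is a bijection from pairs of lists of lengths [n] and [m] to lists of length
    [n + m], and it carries the joint law to that of one longer sample. *)
Lemma entropy_sample_pairE n m :
  entropy P (fun t => (sample Z K n t, sample Z K' m t)) = sample_entropy p (n + m)%N.
Proof.
pose I : set (seq (nat * bool) * seq (nat * bool)) :=
  [set w | size w.1 = n /\ size w.2 = m].
rewrite /sample_entropy (reindex_esum I _ (fun w => w.1 ++ w.2)); last first.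
  split => /=.
  - by move=> [u v] [/= <- <-]; rewrite size_cat.
  - move=> [u v] [u' v']; rewrite !inE => -[/= un vm] [/= un' vm'] /eqP.
    by rewrite eqseq_cat ?un ?un'// => /andP[/eqP -> /eqP ->].
  - move=> w /= wnm; exists (take n w, drop n w); last by rewrite /= cat_take_drop.
    by split => /=; rewrite ?size_drop ?wnm ?addKn// size_takel// wnm leq_addr.
rewrite [RHS]esum_mkcond; apply: eq_esum => -[u v] _.
case: ifPn => [|uv].
  rewrite inE => -[/= un vm]; have uvE := sample_joint_law n m u v un vm.
  rewrite -[sample_pmf p (u ++ v)]/(fine (sample_pmf p (u ++ v))%:E) -uvE.
  by congr (ent_term (fine (P _)))%:E; apply/seteqP; split => t /= => [[-> ->]|[-> ->]].
rewrite (_ : _ @^-1` _ = set0) ?measure0 ?ent_term0//.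
apply/seteqP; split => // t /= [su sv]; move: uv; rewrite notin_setE; apply.
by split; rewrite /= -?su -?sv /sample size_map size_iota.
Qed.

End SampleLaw.

(** * The power law *)

Section ZipfSample.
Context {R : realType} (beta : R).
Hypotheses (hb0 : 0 < beta) (hb1 : beta < 1).

Let p0 := pk_ge0 beta hb0 hb1.
Let p01 k : 0 <= pk beta k <= 1. Proof. by rewrite p0 pk_le1. Qed.

Lemma cvg_series_ent_pk : cvgn (series (fun k => ent_term (pk beta k))).
Proof.
(* Any positive [s < 1 - beta] makes the exponent [(1 - s) / beta] exceed 1. *)
pose s := (1 - beta) / 2.
have b0 := hb0; have b1 := hb1.
have s01 : 0 < s < 1 by rewrite /s; apply/andP; split; lra.
have r1 : 1 < beta^-1 * (1 - s).
  by rewrite mulrC ltr_pdivlMr// mul1r /s; lra.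
pose A := (s * ln 2)^-1 * cnorm beta `^ (1 - s).
have A0 : 0 <= A.
  rewrite mulr_ge0 ?powR_ge0// invr_ge0 mulr_ge0 ?ln_ge0 ?ler1n//.
  by case/andP: s01 => /ltW.
have c := cvg_series_powRN _ r1.
apply: cvgP; apply: cvg_series_shiftS.
apply: (@cvg_series_le _ _ (A * limn (series (fun k : nat => k.+1%:R `^ - (beta^-1 * (1 - s)))))).
  by move=> k; exact: ent_term_ge0.
move=> n; have := series_le_lim _ n (fun=> powR_ge0 _ _) c.
move=> /(ler_wpM2l A0); apply: le_trans.
rewrite !seriesEnat/= mulr_sumr; apply: ler_sum => k _.
apply: (le_trans (ent_term_le _ s (p0 k.+1) s01)); rewrite /= /A.
by rewrite powRM ?powR_ge0 ?(ltW (cnorm_gt0 _ hb0 hb1))// -powRrM mulNr mulrA.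
Qed.

Lemma esum_pk : (\esum_(k in [set: nat]) (pk beta k)%:E = 1)%E.
Proof.
have c := series_pk_cvg beta hb0 hb1.
by rewrite esum_series// ?(cvg_lim _ c)//; apply: cvgP c.
Qed.

Lemma sample_entropy_pk n : sample_entropy (pk beta) n =
  (n%:R * limn (series (fun k => ent_term (pk beta k))) + Ufun beta n)%:E.
Proof.
have H := esum_series _ (fun k => ent_term_ge0 _ (p01 k)) cvg_series_ent_pk.
rewrite (sample_entropyE (pk beta) p0 esum_pk _ H) EFinD; congr (_ + _)%E.
rewrite /expected_distinct esum_series//; last exact: cvg_series_Ufun.
move=> k; rewrite subr_ge0; have /andP[y0 y1] := p01 k.
by rewrite exprn_ile1// ?subr_ge0// lerBlDr lerDl.
Qed.

End ZipfSample.

Theorem mainTheorem9 (R : realType) (beta : R) (hb0 : 0 < beta) (hb1 : beta < 1)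
  (d : measure_display) (T : measurableType d) (P : probability T R)
  (Z : nat -> T -> bool) (K K' : nat -> T -> nat)
  (hZmeas : forall k (b : bool), measurable [set t | Z k t = b])
  (hKmeas : forall i k, measurable [set t | K i t = k])
  (hK'meas : forall j k, measurable [set t | K' j t = k])
  (hZlaw : forall k, P [set t | Z k t = true] = (1 / 2)%:E)
  (hKlaw : forall i k, P [set t | K i t = k] = (pk beta k)%:E)
  (hK'law : forall j k, P [set t | K' j t = k] = (pk beta k)%:E)
  (hindep : mutually_indep P Z K K') :
  exists C : R, 0 < C /\
    ((fun n : nat => Ufun beta n / n%:R `^ beta) @ \oo --> C) /\
    (forall e : R, 0 < e -> exists N : nat, forall n m : nat,
       (N <= n)%N -> (N <= m)%N ->
       `| mutinf P (sample Z K n) (sample Z K' m) / (C * ghc beta n m) - 1 | < e).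
Proof.
have [C C0 U_cvg] := Ufun_div_cvg beta hb0 hb1.
exists C; split=> //; split=> // e e0.
have [N hN] := ghc_ratio_cvg beta hb0 hb1 (Ufun beta) C C0 U_cvg
  (Ufun_homo beta hb0 hb1) (Ufun_concave beta hb0 hb1) e e0.
exists N => n m Nn Nm.
(* The index entropies, [n], [m] and [n + m] times that of [p], cancel, and only the bits remain. *)
suff -> : mutinf P (sample Z K n) (sample Z K' m) =
    Ufun beta n + Ufun beta m - Ufun beta (n + m) by exact: hN.
rewrite /mutinf (entropy_sampleE P (pk beta) Z K K')// (entropy_sampleE' P (pk beta) Z K K')//.
rewrite (entropy_sample_pairE P (pk beta) Z K K')// !sample_entropy_pk//= natrD.
ring.
Qed.
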